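(* Let $Alg\,\mathcal{L}$ be an irreducible CDC-algebra on a Hilbert space $\mathbb{H}$, and let $L\in\mathcal{L}$ be a non-trivial element such that for every $A\in Alg\,\mathcal{L}$, $P_L(Alg\,\mathcal{L})(I-P_L)A=\{0\}$ implies $(I-P_L)A=0$. Let $\delta:Alg\,\mathcal{L}\to Alg\,\mathcal{L}$ be a continuous linear map. Then $\delta$ satisfies \[ A,B\in Alg\,\mathcal{L},\quad AB+BA=P_L\ \Longrightarrow\ 2A\delta(B)+2B\delta(A)=\delta(P_L) \] if and only if $\delta(A)=A\delta(I)$ for all $A\in Alg\,\mathcal{L}$ and $P_L\delta(I)=0$.
   Context: All algebras and vector spaces are over $\mathbb{F}$, where $\mathbb{F}$ is either $\mathbb{R}$ or $\mathbb{C}$. $\mathcal{B}(\mathbb{H})$ is the algebra of bounded linear operators on $\mathbb{H}$, $I$ is the identity operator, and $P_L$ is the (orthogonal) projection of $\mathbb{H}$ onto the closed subspace $L$. A subspace lattice $\mathcal{L}$ on $\mathbb{H}$ is a collection of norm-closed subspaces of $\mathbb{H}$ that is closed under arbitrary intersections ($\wedge$) and arbitrary closed linear spans ($\vee$) and contains $\{0\}$ and $\mathbb{H}$; $L\in\mathcal{L}$ is non-trivial if $L\neq\{0\},\mathbb{H}$. For $L\in\mathcal{L}$ put $L_-=\vee\{M\in\mathcal{L} : L\nsubseteq M\}$. $Alg\,\mathcal{L}=\{T\in\mathcal{B}(\mathbb{H}) : T(L)\subseteq L \text{ for all } L\in\mathcal{L}\}$. $\mathcal{L}$ is a commutative subspace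 lattice (CSL) if the projections of $\mathbb{H}$ onto the members of $\mathcal{L}$ commute with each other, and then $Alg\,\mathcal{L}$ is a CSL-algebra. $\mathcal{L}$ is completely distributive if $L=\vee\{M\in\mathcal{L} : L\nsubseteq M_-\}$ for every $L\in\mathcal{L}$ with $L\neq\{0\}$. $Alg\,\mathcal{L}$ is a CDC-algebra if $\mathcal{L}$ is a completely distributive CSL. A CSL-algebra $Alg\,\mathcal{L}$ is irreducible if and only if its commutant is trivial, i.e. $(Alg\,\mathcal{L})'=\mathbb{C}I$ (only scalar multiples of the identity). The notation $P_L(Alg\,\mathcal{L})(I-P_L)A=\{0\}$ means $P_LT(I-P_L)A=0$ for all $T\in Alg\,\mathcal{L}$. Continuity refers to the operator norm. *)

(* Defs.v *)
From HB Require Import structures.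
From mathcomp Require Import all_boot all_order all_algebra.
From mathcomp Require Import complex.
From mathcomp Require Import all_classical all_reals all_analysis.

Set Implicit Arguments.
Unset Strict Implicit.
Unset Printing Implicit Defensive.

Import Order.TTheory GRing.Theory Num.Theory.
Import numFieldNormedType.Exports.

Local Open Scope classical_set_scope.
Local Open Scope ring_scope.

Variant scalar_kind := RealScalars | ComplexScalars.

Definition scalars (R : realType) (k : scalar_kind) : numFieldType :=
  match k with RealScalars => R | ComplexScalars => R[i] end.

Section scalars.
Context {R : realType} {k : scalar_kind}.

Definition conj_scalar : scalars R k -> scalars R k :=
  match k return scalars R k -> scalars R k with
  | RealScalars => idfun
  | ComplexScalars => @conjc R
  end.

Definition scalar_of_real : R -> scalars R k :=
  match k return R -> scalars R k with
  | RealScalars => idfun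
  | ComplexScalars => real_complex R
  end.

Definition real_part : scalars R k -> R :=
  match k return scalars R k -> R with
  | RealScalars => idfun
  | ComplexScalars => @complex.Re R
  end.

Lemma real_partK (x : scalars R k) : 0 <= x -> scalar_of_real (real_part x) = x.
Proof.
rewrite /real_part /scalar_of_real; case: k x => //= -[a b].
by rewrite lecE /= => /andP[/eqP-> _].
Qed.

Lemma le_scalar_of_real (a b : R) :
  (scalar_of_real a <= scalar_of_real b) = (a <= b).
Proof. by rewrite /scalar_of_real; case: k => //; rewrite lecR. Qed.

End scalars.

(* The inner product is linear in its first argument and conjugate-linear in
   its second one. *)
HB.mixin Record CompleteNormedModule_isHilbert (R : realType) (k : scalar_kind)
    H & CompleteNormedModule (scalars R k) H := {
  inner : {dot H for (@conj_scalar R k)};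
  inner_norm : forall x : H, inner x x = `|x| ^+ 2 }.

#[short(type="hilbertType")]
HB.structure Definition Hilbert (R : realType) (k : scalar_kind) :=
  {H of CompleteNormedModule (scalars R k) H
   & CompleteNormedModule_isHilbert R k H}.

Section bounded_operators.
Context {R : realType} {k : scalar_kind} (H : hilbertType R k).
Local Notation F := (scalars R k).

Definition bounded_linear : {pred H -> H} := fun f =>
  `[< linear f /\ exists M : F, forall x, `|f x| <= M * `|x| >].

Lemma bounded_linear_submod_closed : submod_closed bounded_linear.
Proof.
split.
  apply/asboolP; split; first by move=> a x y; rewrite scaler0 addr0.
  by exists 0 => x; rewrite normr0 mul0r.
move=> a f g /asboolP[lf [M hM]] /asboolP[lg [N hN]]; apply/asboolP; split.
  move=> b x y; rewrite !fctE /= lf lg !scalerDr !scalerA (mulrC a b).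
  by rewrite addrACA.
exists (`|a| * M + N) => x; rewrite !fctE mulrDl (le_trans (ler_normD _ _))//.
by rewrite lerD// normrZ -mulrA ler_wpM2l.
Qed.

HB.instance Definition _ :=
  GRing.isSubmodClosed.Build F (H -> H) bounded_linear
    bounded_linear_submod_closed.

Record bop := BOp { bop_fun :> H -> H; _ : bop_fun \in bounded_linear }.

HB.instance Definition _ := [isSub for bop_fun].
HB.instance Definition _ := [Choice of bop by <:].
HB.instance Definition _ := [SubChoice_isSubLmodule of bop by <:].

Lemma bopP (S T : bop) : (forall x, S x = T x) -> S = T.
Proof. by move=> ST; apply/val_inj/funext. Qed.

Lemma bop_linear (T : bop) : linear T.
Proof. by case: T => f /= /asboolP[]. Qed.

HB.instance Definition _ (T : bop) :=
  GRing.isLinear.Build F H H *:%R T (bop_linear T).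

Lemma bop_bounded (T : bop) : exists M : F, forall x, `|T x| <= M * `|x|.
Proof. by case: T => f /= /asboolP[]. Qed.

Lemma bounded_linear_id : idfun \in bounded_linear.
Proof. by apply/asboolP; split=> //; exists 1 => x; rewrite mul1r. Qed.

Lemma bounded_linear_comp (S T : bop) : S \o T \in bounded_linear.
Proof.
apply/asboolP; split=> [a x y|]; first by rewrite /= !linearP.
have [M hM] := bop_bounded S; have [N hN] := bop_bounded T.
exists (`|M| * N) => x /=; rewrite (le_trans (hM _))//.
rewrite (@le_trans _ _ (`|M| * `|T x|))//; last first.
  by rewrite -mulrA ler_wpM2l.
rewrite -[leLHS]ger0_norm ?(le_trans _ (hM _))//.
by rewrite normrM normr_id.
Qed.

Definition bop1 : bop := BOp bounded_linear_id.
Definition bop_mul (S T : bop) : bop := BOp (bounded_linear_comp S T).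

Fact bop_mulA : associative bop_mul.
Proof. by move=> A B C; apply: bopP. Qed.
Fact bop_mul1l : left_id bop1 bop_mul.
Proof. by move=> A; apply: bopP. Qed.
Fact bop_mul1r : right_id bop1 bop_mul.
Proof. by move=> A; apply: bopP. Qed.
Fact bop_mulDl : left_distributive bop_mul +%R.
Proof. by move=> A B C; apply: bopP. Qed.
Fact bop_mulDr : right_distributive bop_mul +%R.
Proof. by move=> A B C; apply: bopP => x; exact: linearD. Qed.

HB.instance Definition _ := GRing.Zmodule_isPzRing.Build bop
  bop_mulA bop_mul1l bop_mul1r bop_mulDl bop_mulDr.

Definition unit_ball_norms (T : bop) : set R :=
  [set real_part `|T x| | x in [set x : H | `|x| <= 1]].

Definition opnorm (T : bop) : F := scalar_of_real (sup (unit_ball_norms T)).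

Lemma has_sup_unit_ball_norms T : has_sup (unit_ball_norms T).
Proof.
split; first by exists (real_part `|T 0|), 0 => //=; rewrite normr0.
have [M hM] := bop_bounded T; exists (real_part `|M|) => _ [x /= x1 <-].
rewrite -(@le_scalar_of_real R k) !real_partK//.
rewrite (le_trans (hM x))// -[leLHS]ger0_norm ?(le_trans _ (hM x))//.
by rewrite normrM normr_id ler_piMr.
Qed.

Lemma opnorm_ub (T : bop) x : `|x| <= 1 -> `|T x| <= opnorm T.
Proof.
move=> x1; rewrite -[leLHS]real_partK// le_scalar_of_real.
apply: sup_upper_bound; first exact: has_sup_unit_ball_norms.
by exists x.
Qed.

Lemma opnorm_lub (T : bop) (M : F) :
  0 <= M -> (forall x, `|x| <= 1 -> `|T x| <= M) -> opnorm T <= M.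
Proof.
move=> M0 hM; rewrite -[leRHS]real_partK// le_scalar_of_real.
apply: ge_sup; first by case: (has_sup_unit_ball_norms T).
by move=> _ [x /= x1 <-]; rewrite -(@le_scalar_of_real R k) !real_partK// hM.
Qed.

Lemma opnorm_ge0 T : 0 <= opnorm T.
Proof. by rewrite (le_trans _ (@opnorm_ub T 0 _))// normr0. Qed.

Lemma opnorm_le (T : bop) x : `|T x| <= opnorm T * `|x|.
Proof.
have [->|x0] := eqVneq x 0; first by rewrite linear0 !normr0 mulr0.
have nx0 : 0 < `|x| by rewrite normr_gt0.
rewrite -ler_pdivrMr//.
have -> : `|T x| / `|x| = `|T (`|x|^-1 *: x)|.
  by rewrite linearZ /= normrZ normfV normr_id mulrC.
by apply: opnorm_ub; rewrite normrZ normfV normr_id mulVf// gt_eqF.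
Qed.

Lemma opnormD (S T : bop) : opnorm (S + T) <= opnorm S + opnorm T.
Proof.
apply: opnorm_lub => [|x x1]; first by rewrite addr_ge0 ?opnorm_ge0.
by rewrite (le_trans (ler_normD _ _))// lerD// opnorm_ub.
Qed.

Lemma opnormZ (a : F) (T : bop) : opnorm (a *: T) = `|a| * opnorm T.
Proof.
apply/eqP; rewrite eq_le; apply/andP; split.
  apply: opnorm_lub => [|x x1]; first by rewrite mulr_ge0 ?opnorm_ge0.
  by rewrite normrZ ler_wpM2l// opnorm_ub.
have [->|a0] := eqVneq a 0; first by rewrite normr0 mul0r opnorm_ge0.
have na0 : 0 < `|a| by rewrite normr_gt0.
rewrite -ler_pdivlMl//; apply: opnorm_lub => [|x x1].
  by rewrite mulr_ge0 ?invr_ge0 ?opnorm_ge0.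
by rewrite ler_pdivlMl// -normrZ (@opnorm_ub (a *: T)).
Qed.

Lemma opnorm0_eq0 (T : bop) : opnorm T = 0 -> T = 0.
Proof.
move=> T0; apply: bopP => x; apply/eqP; rewrite -normr_le0.
by rewrite (le_trans (opnorm_le T x))// T0 mul0r.
Qed.

HB.instance Definition _ :=
  Lmodule_isNormed.Build F bop opnormD opnormZ opnorm0_eq0.
End bounded_operators.

Section subspace_lattices.
Context {R : realType} {k : scalar_kind} {H : hilbertType R k}.

Definition closed_subspace (M : set H) := submod_closed [in M] /\ closed M.

Definition linear_span (X : set H) : set H :=
  smallest (fun M : set H => submod_closed [in M]) X.

Definition closed_join (C : set (set H)) : set H :=
  closure (linear_span (\bigcup_(M in C) M)).

Definition subspace_lattice (L : set (set H)) :=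
  [/\ L `<=` closed_subspace,
      forall C, C `<=` L -> L (\bigcap_(M in C) M),
      forall C, C `<=` L -> L (closed_join C),
      L [set 0]
    & L setT].

Definition is_orthogonal_projection (M : set H) (P : bop H) :=
  forall x, M (P x) /\ forall y, M y -> inner (x - P x) y = 0.

(* By the projection theorem the default value 0 is never used when [M] is a
   closed subspace. *)
Definition orthoproj (M : set H) : bop H :=
  xget 0 [set P | is_orthogonal_projection M P].

Definition commutative_lattice (L : set (set H)) :=
  forall M N, L M -> L N -> orthoproj M * orthoproj N = orthoproj N * orthoproj M.

Definition lower_join (L : set (set H)) (M : set H) : set H :=
  closed_join [set N | L N /\ ~ (M `<=` N)].

Definition completely_distributive (L : set (set H)) :=
  forall M, L M -> M <> [set 0] ->
    M = closed_join [set N | L N /\ ~ (M `<=` lower_join L N)].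

Definition Alg (L : set (set H)) : set (bop H) :=
  [set T | forall M, L M -> T @` M `<=` M].

Definition commutant (A : set (bop H)) : set (bop H) :=
  [set S | forall T, A T -> S * T = T * S].

Definition irreducible_algebra (A : set (bop H)) :=
  commutant A = range (fun a : scalars R k => a *: (1 : bop H)).

End subspace_lattices.

(* Main.v *)
(* Write P for the projection onto L, Q = 1 - P and d for delta; the condition
   says that AB + BA = 2P implies A d(B) + B d(A) = d(P).  The pair (P, P) gives
   d(P) = 0.  For N in P Alg Q and Z in Q Alg Q the pair
   (P + Z - N - NZ, P + N) gives d(NZ) = N d(Z) and d(N) = N d(Q), and the
   faithfulness hypothesis then yields d(Z) = Z d(Q).  Inverse pairs in P Alg P
   and Hua's identity give d(Y^2) = 2Y d(Y) on P Alg P, so that d kills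
   idempotents, the off-diagonal parts relative to an idempotent, and hence
   every rank-one operator T of P Alg P.  Linearizing, T d(Y) = 0 for all
   such T; complete distributivity provides enough of them to force d(Y) = 0.
   The inverses come from a contraction argument, valid in every invariant
   subspace. *)
Require Import Defs.
From HB Require Import structures.
From mathcomp Require Import all_boot all_order all_algebra.
From mathcomp Require Import complex ring lra.
From mathcomp Require Import all_classical all_reals all_analysis.
Set Implicit Arguments.
Unset Strict Implicit.
Unset Printing Implicit Defensive.
Import Order.TTheory GRing.Theory Num.Theory.
Import numFieldNormedType.Exports.
Local Open Scope classical_set_scope.
Local Open Scope ring_scope.

(** * Maps on a triangular ring *)

Section corner.
(** The subring is a mere set [A] and [d] is a total map controlled only on [A]; this fits [Alg Lat]
    inside [bop H]. *)
Context {B : pzRingType} {A : set B} {P Q : B} {d : B -> B}.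
Hypothesis QE : Q = 1 - P.
Hypothesis two_torsion_free : forall x : B, x + x = 0 -> x = 0.
Hypothesis A1 : A 1.
Hypothesis AB : forall x y, A x -> A y -> A (x - y).
Hypothesis AM : forall x y, A x -> A y -> A (x * y).
Hypothesis AP : A P.
Hypothesis PP : P * P = P.
Hypothesis PxP : forall x, A x -> P * x * P = x * P.
Hypothesis dA : forall x, A x -> A (d x).
Hypothesis dD : forall x y, A x -> A y -> d (x + y) = d x + d y.
Hypothesis dP_eq : forall x y, A x -> A y ->
  x * y + y * x = P + P -> x * d y + y * d x = d P.

Let A0 : A 0. Proof. by rewrite -(subrr (1 : B)); exact: AB. Qed.
Let AN x : A x -> A (- x). Proof. by move=> Ax; rewrite -sub0r; exact: AB. Qed.
Let AD x y : A x -> A y -> A (x + y).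
Proof. by move=> Ax Ay; rewrite -[y]opprK; apply: AB => //; exact: AN. Qed.
Let AQ : A Q. Proof. by rewrite QE; exact: AB. Qed.

Let d0 : d 0 = 0.
Proof. by apply: (addrI (d 0)); rewrite -dD// !addr0. Qed.

Let dN x : A x -> d (- x) = - d x.
Proof.
by move=> Ax; apply: (addrI (d x)); rewrite -dD ?subrr//; exact: AN.
Qed.

Let dB x y : A x -> A y -> d (x - y) = d x - d y.
Proof. by move=> Ax Ay; rewrite dD ?dN//; exact: AN. Qed.

Let PQ : P * Q = 0. Proof. by rewrite QE mulrBr mulr1 PP subrr. Qed.
Let QP : Q * P = 0. Proof. by rewrite QE mulrBl mul1r PP subrr. Qed.
Let QQ : Q * Q = Q. Proof. by rewrite {2}QE mulrBr QP subr0 mulr1. Qed.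

(** The pair [(P, P)] gives [2 P d(P) = d(P)]; multiplying by [P] on the left kills [P d(P)], hence
    [d(P)]. *)
Lemma corner_dP : d P = 0.
Proof.
have h : P * d P + P * d P = d P by apply: dP_eq => //; rewrite PP.
have h0 : P * d P = 0.
  by apply: (addIr (P * d P)); rewrite add0r -[in RHS]h mulrDr mulrA PP.
by rewrite -h h0 addr0.
Qed.

(** Mutual inverses in the corner ring [P A P], whose unit is [P]. *)
Definition corner_inv x y :=
  [/\ [/\ A x, P * x = x & x * P = x], [/\ A y, P * y = y & y * P = y],
      x * y = P & y * x = P].

Lemma corner_inv_eq x y : corner_inv x y -> x * d y + y * d x = 0.
Proof.
case=> -[Ax _ _] [Ay _ _] xy yx; rewrite dP_eq ?corner_dP//.
by rewrite xy yx.
Qed.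

(** Since [z] annihilates [y] on both sides, [(x + z, y)] is again an admissible pair; subtract the
    equation for [(x, y)]. *)
Lemma corner_inv_compl x y z : corner_inv x y -> A z -> z = Q * z * Q ->
  z * d y + y * d z = 0.
Proof.
move=> I Az zE; have [[Ax Px xP] [Ay Py yP] xy yx] := I.
have zy : z * y = 0 by rewrite -Py zE !mulrA -(mulrA _ Q) QP mulr0 mul0r.
have yz : y * z = 0 by rewrite -yP zE !mulrA -(mulrA _ P) PQ mulr0 !mul0r.
have : (x + z) * d y + y * d (x + z) = d P.
  apply: dP_eq => //; first exact: AD.
  by rewrite mulrDl mulrDr zy yz !addr0 xy yx.
rewrite corner_dP dD// mulrDl mulrDr addrACA.
by rewrite (corner_inv_eq I) add0r.
Qed.

Lemma corner_invP : corner_inv P P.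
Proof. by split. Qed.

Lemma mulP_compl z : A z -> z = Q * z * Q -> P * d z = 0.
Proof.
move=> Az zE; have := corner_inv_compl corner_invP Az zE.
by rewrite corner_dP mulr0 add0r.
Qed.

Lemma mulQ_inv x y : corner_inv x y -> P * d x = d x.
Proof.
move=> [I1 I2 xy yx]; have [_ _ xP] := I1.
have QQQ : Q = Q * Q * Q by rewrite !QQ.
(* Taking [Q] for the complementary element yields [Q d(x) + x d(Q) = 0], where
   [x d(Q) = x P d(Q) = 0]. *)
have /corner_inv_compl/(_ AQ QQQ) : corner_inv y x by split.
have -> : x * d Q = 0 by rewrite -xP -mulrA mulP_compl// mulr0.
by rewrite addr0 QE mulrBl mul1r => /eqP; rewrite subr_eq0 => /eqP.
Qed.

Lemma d_offdiag_compl n z : A n -> A z -> n = P * n * Q -> z = Q * z * Q ->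
  P * d n = d n /\ d (n * z) = n * d z.
Proof.
move=> An Az nE zE.
have offP m : m = P * m * Q -> P * m = m by move->; rewrite !mulrA PP.
have off0 m : m = P * m * Q -> m * P = 0 by move->; rewrite -mulrA QP mulr0.
have offQ m : m = P * m * Q -> Q * m = 0 by move->; rewrite !mulrA QP !mul0r.
(* The products of [P + w - m - mw] and [P + m] in the two orders are [P + m] and [P - m], so they
   sum to [2P]. *)
have key m w : A m -> A w -> m = P * m * Q -> w = Q * w * Q ->
    (P + w - (m + m * w)) * d m + (P + m) * d (w - (m + m * w)) = 0.
  move=> Am Aw mE wE.
  have Qw : Q * w = w by rewrite wE !mulrA QQ.
  have Pw : P * w = 0 by rewrite -Qw mulrA PQ mul0r.
  have wP : w * P = 0 by rewrite wE -(mulrA _ Q) QP mulr0.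
  have wm : w * m = 0 by rewrite -(offP _ mE) mulrA wP mul0r.
  have mm : m * m = 0 by rewrite -{2}(offP _ mE) mulrA off0// mul0r.
  have Amw := AM Am Aw; have Ab := AD Am Amw.
  have [mP Pm] := (off0 _ mE, offP _ mE).
  rewrite -[RHS]corner_dP -[in RHS](@dP_eq (P + w - (m + m * w)) (P + m)).
  - rewrite [d (P + m)]dD// corner_dP add0r -addrA [d (P + _)]dD ?corner_dP
    ?add0r//.
    exact: AB.
  - by apply: AB => //; exact: AD.
  - exact: AD.
  - rewrite !(mulrDr, mulrBr, mulrDl, mulrBl, mulNr, mulrN) !mulrA.
    rewrite mP Pm PP Pw wP wm mm !mul0r -(mulrA m) wP -(mulrA m) wm !mulr0.
    by rewrite !(addr0, add0r, subr0) addrACA opprD [m + _]addrA subrr sub0r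
      !addrA addrK.
(* Taking [w = Q] in [key] and multiplying by [Q] on the left leaves [Q d(m) = 0]. *)
have Qd m : A m -> m = P * m * Q -> P * d m = d m.
  move=> Am mE; have QQQ : Q = Q * Q * Q by rewrite !QQ.
  have /(congr1 ( *%R Q)) := key m Q Am AQ mE QQQ.
  have e1 : Q * (P + Q - (m + m * Q)) = Q.
    by rewrite mulrBr !mulrDr mulrA (offQ m)// QP QQ mul0r !addr0 add0r subr0.
  have e2 : Q * (P + m) = 0 by rewrite mulrDr QP (offQ m)// addr0.
  rewrite mulr0 mulrDr 2!mulrA e1 e2 mul0r addr0 QE mulrBl mul1r.
  by move=> /eqP; rewrite subr_eq0 => /eqP.
split; first exact: Qd.
have Anz := AM An Az.
have nzE : n * z = P * (n * z) * Q.
  by rewrite !mulrA offP// -(mulrA n) {2}zE -(mulrA _ Q) QQ -zE.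
have zP : z * P = 0 by rewrite zE -(mulrA _ Q) QP mulr0.
(* As [d n] and [d (n * z)] lie in the range of [P], the two summands reduce to [d(n)] and
   [n d(z) - d(n) - d(nz)]. *)
have := key n z An Az nE zE; rewrite dB ?dD//; last exact: AD.
have [dn dnz] := (Qd _ An nE, Qd _ Anz nzE).
have -> : (P + z - (n + n * z)) * d n = d n.
  rewrite -dn mulrA; congr (_ * _).
  by rewrite mulrBl !mulrDl PP zP off0// -(mulrA n) zP mulr0 !addr0 subr0.
have -> : (P + n) * (d z - (d n + d (n * z))) = n * d z - (d n + d (n * z)).
  rewrite mulrBr mulrDl mulP_compl// add0r; congr (_ - _).
  rewrite -{1}dn -{1}dnz -mulrDr mulrA mulrDl PP off0// addr0 mulrDr.
  by rewrite dn dnz.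
rewrite opprD addrCA [d n + _]addrA subrr sub0r.
by move=> /eqP; rewrite subr_eq0 => /eqP.
Qed.

(** * Inverse pairs and squares in the corner ring *)

Lemma corner_invM x y u v : corner_inv x y -> corner_inv u v -> x * u = u * x ->
  corner_inv (x * u) (v * y).
Proof.
move=> [[Ax Px xP] [Ay Py yP] xy yx] [[Au Pu uP] [Av Pv vP] uv vu] xu; split.
- by split; [exact: AM|rewrite mulrA Px|rewrite -mulrA uP].
- by split; [exact: AM|rewrite mulrA Pv|rewrite -mulrA yP].
- by rewrite mulrA -(mulrA x) uv xP xy.
- by rewrite mulrA -(mulrA v) yx vP vu.
Qed.

Lemma d_corner_inv x y : corner_inv x y -> d y = - (y * y * d x).
Proof.
move=> I; have [[Ax Px xP] [Ay Py yP] xy yx] := I.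
have I' : corner_inv y x by split.
have /(congr1 ( *%R y)) := corner_inv_eq I.
rewrite mulr0 mulrDr !mulrA yx (mulQ_inv I') => /eqP.
by rewrite addr_eq0 => /eqP.
Qed.

(* Hua's identity x^-1 - (x + 1)^-1 = (x^2 + x)^-1, with both sides
   evaluated by [d_corner_inv]. *)
Lemma d_sqr_inv x u v : corner_inv x u -> corner_inv (x + P) v ->
  d (x * x) = x * d x + x * d x.
Proof.
move=> Iu Iv; have [[Ax Px xP] [Au Pu uP] xu ux] := Iu.
have [[_ _ _] [Av Pv vP] xv vx] := Iv.
have cx : x * (x + P) = (x + P) * x by rewrite mulrDr mulrDl Px xP.
have Iw := corner_invM Iu Iv cx.
have uvE : u - v = u * v.
  rewrite -[in LHS]uP -[in X in X - _]xv mulrA mulrDr ux uP mulrDl Pv.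
  by rewrite addrC addKr.
have vuE : u - v = v * u.
  rewrite -[in LHS]Pu -[in X in X - _]vx -mulrA mulrDl xu Pu mulrDr vP.
  by rewrite addrC addKr.
have Axx := AM Ax Ax.
have dw : d (x * (x + P)) = d (x * x) + d x by rewrite mulrDr xP dD.
have dxP : d (x + P) = d x by rewrite dD// corner_dP addr0.
have := d_corner_inv Iw; rewrite -vuE dB// (d_corner_inv Iu) (d_corner_inv Iv).
have [Pdx Pdxx] := (mulQ_inv Iu, mulQ_inv (corner_invM Iu Iu (erefl _))).
set w := x * (x + P) in Iw *; set D := d w.
have wuv : w * (u - v) = P by rewrite vuE; case: Iw.
have wu : w * u = x + P by rewrite /w cx -mulrA xu mulrDl xP PP.
have wv : w * v = x by rewrite /w -mulrA xv.
have PD : P * D = D by rewrite /D dw mulrDr Pdxx Pdx.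
rewrite dxP opprK addrC -[in RHS]mulrA => /eqP; rewrite -subr_eq0 opprK.
have -> : v * v * d x - u * u * d x = - ((u - v) * ((u + v) * d x)).
  rewrite -mulrBl mulrA -[RHS]mulNr; congr (_ * _).
  rewrite mulrBl opprB !mulrDr -vuE -uvE [_ - v + _]addrC.
  by rewrite [u * u + _]addrC addrKA.
(* Here [(u - v)^2 D = (u - v)(u + v) d(x)] and [w] inverts [u - v], so
   [D = w (u + v) d(x) = (2x + P) d(x)]. *)
rewrite addrC subr_eq0 => /eqP/(congr1 ( *%R (w * w))).
rewrite -!(mulrA w) !(mulrA w (u - v)) wuv !(mulrA P).
have -> : P * (u - v) = u - v by rewrite mulrBr Pu Pv.
have -> : P * (u + v) = u + v by rewrite mulrDr Pu Pv.
rewrite !mulrA wuv PD mulrDr wu wv !mulrDl Pdx /D dw.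
by rewrite [RHS]addrAC; exact: addIr.
Qed.

(** Two consecutive shifts are required because [d_sqr_inv] inverts both [x] and [x + P]. *)
Hypothesis inv_shift : forall x, A x ->
  exists n, (exists y, [/\ A y, (x + n%:R) * y = 1 & y * (x + n%:R) = 1])
    /\ exists y, [/\ A y, (x + n.+1%:R) * y = 1 & y * (x + n.+1%:R) = 1].

Lemma A_natmul x n : A x -> A (x *+ n).
Proof.
by move=> Ax; elim: n => [|n IH]; rewrite ?mulr0n// mulrS; exact: AD.
Qed.

(** [P] commutes with [x + n], hence with its inverse, and compressing both to the corner keeps them
    inverse. *)
Lemma corner_inv_shift x n y : A x -> P * x = x -> x * P = x ->
  A y -> (x + n%:R) * y = 1 -> y * (x + n%:R) = 1 ->
  corner_inv (x + P *+ n) (P * y).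
Proof.
move=> Ax Px xP Ay xy yx.
have cP : P * (x + n%:R) = (x + n%:R) * P.
  by rewrite mulrDr mulrDl Px xP mulr_natr mulr_natl.
have yP : y * P = P * y.
  by rewrite -[y * P]mulr1 -xy mulrA -(mulrA y) cP mulrA yx mul1r.
have xE : x + P *+ n = P * (x + n%:R) by rewrite mulrDr Px mulr_natr.
split.
- split; rewrite ?xE ?cP.
  + by rewrite -cP -xE; apply: AD => //; exact: A_natmul.
  + by rewrite mulrA cP -mulrA PP.
  + by rewrite -mulrA PP.
- split; first exact: AM.
  + by rewrite mulrA PP.
  + by rewrite -mulrA yP mulrA PP.
- by rewrite xE cP -mulrA (mulrA P) PP -yP mulrA xy mul1r.
- by rewrite xE -mulrA cP (mulrA y) yx mul1r PP.
Qed.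

Lemma corner_shift x : A x -> P * x = x -> x * P = x ->
  exists n u v, corner_inv (x + P *+ n) u /\ corner_inv (x + P *+ n + P) v.
Proof.
move=> Ax Px xP; have [n [[y [Ay xy yx]] [z [Az xz zx]]]] := inv_shift Ax.
exists n, (P * y), (P * z); split; first exact: corner_inv_shift.
by rewrite -addrA -mulrSr; exact: corner_inv_shift.
Qed.

Let d_natmul x n : A x -> d (x *+ n) = d x *+ n.
Proof.
move=> Ax; elim: n => [|n IH]; first by rewrite !mulr0n d0.
by rewrite !mulrS dD// ?IH//; exact: A_natmul.
Qed.

Lemma mulP_d_corner x : A x -> P * x = x -> x * P = x -> P * d x = d x.
Proof.
move=> Ax Px xP; have [n [u [v [Iu _]]]] := corner_shift Ax Px xP.
have := mulQ_inv Iu; rewrite dD//; last exact: A_natmul.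
by rewrite d_natmul// corner_dP mul0rn addr0.
Qed.

(** Passing from [x] to [x + nP] adds [2n d(x)] to both sides, because [d(P) = 0] and
    [P d(x) = d(x)]; so an invertible shift suffices. *)
Lemma d_sqr x : A x -> P * x = x -> x * P = x ->
  d (x * x) = x * d x + x * d x.
Proof.
move=> Ax Px xP; have [n [u [v [Iu Iv]]]] := corner_shift Ax Px xP.
have := d_sqr_inv Iu Iv.
have AnP : A (P *+ n) by exact: A_natmul.
have Axx : A (x * x) by exact: AM.
have Axn : A (x *+ n) by exact: A_natmul.
have -> : (x + P *+ n) * (x + P *+ n) = x * x + x *+ n + x *+ n + P *+ n *+ n.
  rewrite mulrDl !mulrDr mulrnAr xP mulrnAl Px mulrnAl mulrnAr PP.
  by rewrite !addrA.
rewrite !dD ?d_natmul// ?corner_dP ?mul0rn ?addr0;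
  try by do ?[exact: A_natmul|apply: AD].
by rewrite mulrDl mulrnAl mulP_d_corner// [RHS]addrACA -[LHS]addrA => /addIr.
Qed.

(** Polarization of [d_sqr]. *)
Lemma d_jordan x y : A x -> P * x = x -> x * P = x ->
  A y -> P * y = y -> y * P = y ->
  d (x * y) + d (y * x) = (x * d y + x * d y) + (y * d x + y * d x).
Proof.
move=> Ax Px xP Ay Py yP.
have [Axy Ayx Axx Ayy] := And4 (AM Ax Ay) (AM Ay Ax) (AM Ax Ax) (AM Ay Ay).
have := @d_sqr (x + y) (AD Ax Ay); rewrite mulrDr mulrDl Px Py xP yP.
move=> /(_ erefl erefl).
rewrite mulrDl !mulrDr !dD//; try by do ?apply: AD.
rewrite !d_sqr// mulrDl !mulrDr [RHS]addrACA (addrACA (x * d x) (x * d y))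
  (addrACA (y * d x)).
set a := x * d x + _; set b := y * d y + _.
by rewrite !(addrA _ _ b) => /addIr; rewrite -!(addrA a) => /addrI.
Qed.

Lemma d_idem e : A e -> P * e = e -> e * P = e -> e * e = e -> d e = 0.
Proof.
move=> Ae Pe eP ee; have := d_sqr Ae Pe eP; rewrite ee => h.
have h0 : e * d e = 0.
  by apply: (addIr (e * d e)); rewrite add0r [in RHS]h mulrDr !mulrA ee.
by rewrite h h0 addr0.
Qed.

(** With [d(e) = 0], [d_jordan] reads [d(x) = 2 e d(x)]; multiplying by [e] gives [e d(x) = 0]. *)
Lemma d_offdiag_idem e x : A e -> P * e = e -> e * P = e -> e * e = e ->
  A x -> P * x = x -> x * P = x -> e * x = x -> x * e = 0 -> d x = 0.
Proof.
move=> Ae Pe eP ee Ax Px xP ex xe; have := d_jordan Ae Pe eP Ax Px xP.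
rewrite ex xe d0 addr0 (d_idem Ae)// mulr0 !addr0 => h.
have h0 : e * d x = 0.
  by apply: (addIr (e * d x)); rewrite add0r [in RHS]h mulrDr !mulrA ee.
by rewrite h h0 addr0.
Qed.

Lemma mul_d_eq0 x y : A x -> P * x = x -> x * P = x ->
  A y -> P * y = y -> y * P = y ->
  d x = 0 -> d (x * y) = 0 -> d (y * x) = 0 -> x * d y = 0.
Proof.
move=> Ax Px xP Ay Py yP dx dxy dyx; have := d_jordan Ax Px xP Ay Py yP.
rewrite dx dxy dyx mulr0 !addr0 => /esym.
exact: two_torsion_free.
Qed.

(** Peirce decomposition: [Q x P = 0] leaves three blocks. The corner block is killed by [d], the
    other two are treated separately, and [d(1) = d(Q)]. *)
Lemma d_eq_mulr : 
  (forall x, A x -> (forall t, A t -> P * t * Q * x = 0) -> Q * x = 0) ->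
  (forall x, A x -> P * x = x -> x * P = x -> d x = 0) ->
  (forall x, A x -> d x = x * d 1) /\ P * d 1 = 0.
Proof.
move=> faith d_corner.
have QQQ : Q = Q * Q * Q by rewrite !QQ.
have PdQ : P * d Q = 0 by exact: mulP_compl.
have d1 : d 1 = d Q by rewrite QE dB// corner_dP subr0.
rewrite d1; split => // x Ax.
have offE : P * x * Q = P * (P * x * Q) * Q.
  by rewrite !mulrA PP -(mulrA _ Q) QQ.
have complE z : Q * z * Q = Q * (Q * z * Q) * Q.
  by rewrite !mulrA QQ -(mulrA _ Q) QQ.
have Aoff z : A z -> A (P * z * Q) by move=> Az; do ?apply: AM.
have Acompl z : A z -> A (Q * z * Q) by move=> Az; do ?apply: AM.
have doff n : A n -> n = P * n * Q -> d n = n * d Q.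
  move=> An nE; have [_] := d_offdiag_compl An AQ nE QQQ.
  by rewrite {1}nE -mulrA QQ -nE.
(* For [n = P t Q], both [n d(z)] and [n z d(Q)] equal [d(nz)]. So [P t Q] annihilates
   [d(z) - z d(Q)] for every [t], and faithfulness applies. *)
have dcompl z : A z -> z = Q * z * Q -> d z = z * d Q.
  move=> Az zE; apply/eqP; rewrite -subr_eq0; apply/eqP.
  have Qz : Q * z = z by rewrite zE !mulrA QQ.
  have zQ : z * Q = z by rewrite zE -mulrA QQ.
  have Pz : P * z = 0 by rewrite -Qz mulrA PQ mul0r.
  have Aw : A (d z - z * d Q).
    by apply: AB; [exact: dA|apply: AM => //; exact: dA].
  have : P * (d z - z * d Q) = 0.
    by rewrite mulrBr mulP_compl// mulrA Pz mul0r subr0.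
  suff : Q * (d z - z * d Q) = 0.
    by move=> h1 h2; rewrite -[LHS]mul1r -(subrK P 1) -QE mulrDl h1 h2 addr0.
  apply: faith => // t At.
  have ntE : P * t * Q = P * (P * t * Q) * Q.
    by rewrite !mulrA PP -(mulrA _ Q) QQ.
  have [_ dnz] := d_offdiag_compl (Aoff _ At) Az ntE zE.
  rewrite mulrBr -dnz mulrA doff ?subrr//; first by apply: AM => //;
    exact: Aoff.
  by rewrite !mulrA PP -(mulrA _ z) zQ.
have QxP : Q * x * P = 0 by rewrite QE mulrBl mul1r mulrBl PxP// subrr.
have PQ1 : P + Q = 1 by rewrite QE addrC subrK.
have xE : x = P * x * P + (P * x * Q + Q * x * Q).
  rewrite addrA -mulrDr PQ1 mulr1 -[Q * x * Q]add0r -QxP -mulrDr PQ1 mulr1.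
  by rewrite -mulrDl PQ1 mul1r.
have Ac : A (P * x * P) by do ?apply: AM.
have dc : d (P * x * P) = 0.
  by apply: d_corner => //; rewrite ?mulrA ?PP// -mulrA PP.
have xdQ : x * d Q = P * x * Q * d Q + Q * x * Q * d Q.
  by rewrite {1}xE mulrDl -(mulrA _ P) PdQ mulr0 add0r mulrDl.
rewrite xdQ {1}xE dD//; last by apply: AD; [exact: Aoff|exact: Acompl].
rewrite dc add0r dD; [|exact: Aoff|exact: Acompl].
by rewrite (doff _ (Aoff x Ax) offE) (dcompl _ (Acompl x Ax) (complE x)).
Qed.
End corner.

(** * Geometry of Hilbert spaces *)

Section real_scalars.
Context {R : realType} {k : scalar_kind}.
Local Notation F := (scalars R k).
Local Notation sor := (@scalar_of_real R k).

Lemma scalar_of_realD (a b : R) : sor (a + b) = sor a + sor b.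
Proof. by rewrite /scalar_of_real; case: k => //=; rewrite rmorphD. Qed.

Lemma scalar_of_realM (a b : R) : sor (a * b) = sor a * sor b.
Proof. by rewrite /scalar_of_real; case: k => //=; rewrite rmorphM. Qed.

Lemma scalar_of_real0 : sor 0 = 0.
Proof. by rewrite /scalar_of_real; case: k => //=; rewrite rmorph0. Qed.

Lemma scalar_of_real1 : sor 1 = 1.
Proof. by rewrite /scalar_of_real; case: k => //=; rewrite rmorph1. Qed.

Lemma scalar_of_real_inj : injective sor.
Proof.
move=> a b ab; apply/eqP; rewrite eq_le -!(@le_scalar_of_real R k) ab.
by rewrite lexx.
Qed.

Lemma lt_scalar_of_real (a b : R) : (sor a < sor b) = (a < b).
Proof.
by rewrite !lt_neqAle le_scalar_of_real (inj_eq scalar_of_real_inj).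
Qed.

Lemma real_part_eq (x : F) (a : R) : x = sor a -> real_part x = a.
Proof. by move=> ->; rewrite /real_part /scalar_of_real; case: k. Qed.

Lemma mul_conj_scalar (x : F) : x * conj_scalar x = `|x| ^+ 2.
Proof.
rewrite /conj_scalar; case: k x => /= x; first by rewrite real_normK// num_real.
by rewrite sqr_normc.
Qed.

Lemma conj_scalar0 : conj_scalar (0 : F) = 0.
Proof. by rewrite /conj_scalar; case: k => //=; rewrite raddf0. Qed.

End real_scalars.

Section hilbert.
Context {R : realType} {k : scalar_kind} {H : hilbertType R k}.
Local Notation F := (scalars R k).
Local Notation sor := (@scalar_of_real R k).
Implicit Types x y z : H.

(** The norm takes values in [F], which is only partially ordered in the complex case; a real-valued
    copy gives access to infima, [lra] and [nra]. *)
Definition rnorm (x : H) : R := real_part `|x|.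

Lemma rnormE x : sor (rnorm x) = `|x|.
Proof. exact: real_partK. Qed.

Lemma rnorm_ge0 x : 0 <= rnorm x.
Proof. by rewrite -(@le_scalar_of_real R k) rnormE scalar_of_real0. Qed.

Lemma rnorm_leP x y : (rnorm x <= rnorm y) = (`|x| <= `|y|).
Proof. by rewrite -!rnormE le_scalar_of_real. Qed.

Lemma rnormD x y : rnorm (x + y) <= rnorm x + rnorm y.
Proof.
by rewrite -(@le_scalar_of_real R k) scalar_of_realD !rnormE ler_normD.
Qed.

Lemma rnormN x : rnorm (- x) = rnorm x.
Proof. by rewrite /rnorm normrN. Qed.

Lemma rnormB x y : rnorm (x - y) = rnorm (y - x).
Proof. by rewrite /rnorm distrC. Qed.

Lemma rnorm_eq0 x : rnorm x = 0 -> x = 0.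
Proof.
by move=> x0; apply: normr0_eq0; rewrite -rnormE x0 scalar_of_real0.
Qed.

Lemma rnormZ (a : F) x : rnorm (a *: x) = real_part `|a| * rnorm x.
Proof.
by apply: real_part_eq; rewrite scalar_of_realM rnormE real_partK// normrZ.
Qed.

Lemma innerDl x y z : inner (x + y) z = inner x z + inner y z.
Proof. exact: linearDl. Qed.
Lemma innerDr x y z : inner z (x + y) = inner z x + inner z y.
Proof. exact: linearDr. Qed.
Lemma innerNl x z : inner (- x) z = - inner x z.
Proof. exact: linearNl. Qed.
Lemma innerNr x z : inner z (- x) = - inner z x.
Proof. exact: linearNr. Qed.
Lemma innerBl x y z : inner (x - y) z = inner x z - inner y z.
Proof. exact: linearBl. Qed.
Lemma innerBr x y z : inner z (x - y) = inner z x - inner z y.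
Proof. exact: linearBr. Qed.
Lemma innerZl (a : F) x z : inner (a *: x) z = a * inner x z.
Proof. exact: linearZl_LR. Qed.
Lemma innerZr (a : F) x z : inner z (a *: x) = conj_scalar a * inner z x.
Proof. exact: linearZr_LR. Qed.
Lemma inner_conj x y : inner x y = conj_scalar (inner y x).
Proof. by rewrite [LHS]hermitian_subproof expr0 mul1r. Qed.

Lemma inner_eq0C x y : inner x y = 0 -> inner y x = 0.
Proof. by move=> xy; rewrite inner_conj xy conj_scalar0. Qed.

Lemma inner_eq0 x : inner x x = 0 -> x = 0.
Proof.
by rewrite inner_norm => /eqP; rewrite expf_eq0/= normr_eq0 => /eqP.
Qed.

(** Pythagoras. It yields both the Cauchy-Schwarz inequality and the orthogonality of a best
    approximation. *)
Lemma norm_sub_proj x y : y != 0 ->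
  `|x - (inner x y / inner y y) *: y| ^+ 2 =
  `|x| ^+ 2 - `|inner x y| ^+ 2 / `|y| ^+ 2.
Proof.
move=> y0; have yy0 : inner y y != 0.
  by apply: contra y0 => /eqP/inner_eq0 ->.
set c := inner x y / inner y y.
have h : inner (x - c *: y) y = 0.
  by rewrite innerBl innerZl /c divfK// subrr.
rewrite -inner_norm innerBr innerZr h mulr0 subr0 innerBl innerZl inner_norm.
by rewrite (inner_conj y x) /c mulrAC mul_conj_scalar inner_norm.
Qed.

Lemma Cauchy_Schwarz x y : `|inner x y| <= `|x| * `|y|.
Proof.
have [->|y0] := eqVneq y 0.
  by rewrite [inner x 0]linear0r !normr0 mulr0.
rewrite -(@ler_pXn2r _ 2)// ?nnegrE// exprMn -ler_pdivrMr ?exprn_gt0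
  ?normr_gt0//.
by rewrite -subr_ge0 -norm_sub_proj// exprn_ge0.
Qed.

Lemma parallelogram x y :
  rnorm (x + y) ^+ 2 + rnorm (x - y) ^+ 2 =
  (rnorm x ^+ 2 + rnorm y ^+ 2) *+ 2.
Proof.
apply: (@scalar_of_real_inj R k).
rewrite !(mulr2n, expr2) !(scalar_of_realD, scalar_of_realM) !rnormE.
rewrite -!expr2 -!inner_norm.
rewrite !(innerDr, innerDl, innerNr, innerNl).
ring.
Qed.

(** * Completeness and the projection theorem *)

Lemma rnorm_complete (M : set H) (u : nat -> H) : closed M ->
  (forall n, M (u n)) ->
  (forall e, 0 < e -> exists N, forall n, (N <= n)%N ->
    rnorm (u N - u n) < e) ->
  exists2 l, M l & forall e, 0 < e -> exists N, forall n, (N <= n)%N ->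
    rnorm (l - u n) < e.
Proof.
move=> cM Mu cu.
have sorP (e : F) : 0 < e -> exists2 e', 0 < e' & sor e' = e.
  move=> e0; have eE := real_partK (ltW e0); exists (real_part e) => //.
  by rewrite -(@lt_scalar_of_real R k) eE scalar_of_real0.
have /cauchy_cvg/cvg_ex[l ul] : cauchy (u @ \oo).
  apply: cauchy_exP => _ /sorP[e e0 <-]; have [N hN] := cu e e0.
  exists (u N), N => // n /= Nn; rewrite -ball_normE /=.
  by rewrite -rnormE lt_scalar_of_real hN.
exists l; first by apply: (closed_cvg M cM _ _ ul); apply: nearW.
move=> e e0; have se0 : 0 < sor e by rewrite -scalar_of_real0 lt_scalar_of_real.
have /cvgrPdist_lt/(_ _ se0)[N _ hN] := ul; exists N => n Nn.
by rewrite -(@lt_scalar_of_real R k) rnormE; exact: hN.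
Qed.

Lemma closed_subspace_lin (M : set H) (a : F) x y : closed_subspace M ->
  M x -> M y -> M (a *: x + y).
Proof.
move=> [[_ lM] _] Mx My; apply/set_mem.
by apply: (lM a x y); rewrite inE.
Qed.

Lemma closed_subspace0 (M : set H) : closed_subspace M -> M 0.
Proof. by move=> [[M0 _] _]; apply/set_mem. Qed.

Lemma closed_subspaceD (M : set H) x y : closed_subspace M ->
  M x -> M y -> M (x + y).
Proof.
by move=> cM Mx My; rewrite -[x]scale1r; exact: closed_subspace_lin.
Qed.

Lemma closed_subspaceZ (M : set H) (a : F) x : closed_subspace M ->
  M x -> M (a *: x).
Proof.
move=> cM Mx; rewrite -[_ *: _]addr0; apply: closed_subspace_lin => //.
exact: closed_subspace0.
Qed.

Lemma closed_subspaceB (M : set H) x y : closed_subspace M ->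
  M x -> M y -> M (x - y).
Proof.
move=> cM Mx My; rewrite -scaleN1r; apply: closed_subspaceD => //.
exact: closed_subspaceZ.
Qed.

(** A minimizing sequence for the distance [d] is Cauchy by the parallelogram law, and its limit
    attains the infimum. *)
Lemma best_approximation (M : set H) x : closed_subspace M ->
  exists2 l, M l & forall y, M y -> rnorm (x - l) <= rnorm (x - y).
Proof.
move=> cM; have M0 := closed_subspace0 cM.
pose D := [set rnorm (x - y) | y in M]; pose d := inf D.
have hD : has_inf D.
  by split; [exists (rnorm (x - 0)), 0|exists 0 => _ [y _ <-];
    exact: rnorm_ge0].
have dle y : M y -> d <= rnorm (x - y).
  by move=> My; apply: ge_inf; [case: hD|exists y].
have d0 : 0 <= d.
  by apply: lb_le_inf; [case: hD|move=> _ [y _ <-]; exact: rnorm_ge0].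
have /choice[u hu] :
  forall n : nat, exists y, M y /\ rnorm (x - y) < d + n.+1%:R^-1.
  move=> n; have n0 : 0 < n.+1%:R^-1 :> R by rewrite invr_gt0.
  by have [_ [y My <-] hy] := inf_adherent n0 hD; exists y.
have inv_small (e : R) : 0 < e ->
    exists N, forall n, (N <= n)%N -> n.+1%:R^-1 < e.
  move=> e0; exists (Num.bound e^-1) => n Nn.
  rewrite invf_plt ?posrE//; apply: (@lt_le_trans _ _ (Num.bound e^-1)%:R).
    by apply: archi_boundP; rewrite invr_ge0 ltW.
  by rewrite ler_nat ltnW.
(* The midpoint [z] is at distance at least [d] from [x]. With [e = 1/(n+1)], the squared gap is at
   most [4(d + e)^2 - 4d^2 = 8de + 4e^2], which is at most [(8d + 4)e] because [e <= 1]. *)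
have key n m : (n <= m)%N ->
    rnorm (u n - u m) ^+ 2 <= (d *+ 8 + 4) * n.+1%:R^-1.
  move=> nm; have [[Mn hn] [Mm hm]] := (hu n, hu m).
  pose z := 2^-1 *: (u n + u m).
  have Mz : M z by apply: closed_subspaceZ => //; exact: closed_subspaceD.
  have := parallelogram (x - u n) (x - u m).
  have -> : x - u n + (x - u m) = (2 : F) *: (x - z).
    rewrite /z scalerBr scalerA divff// scale1r scaler_nat mulr2n.
    by rewrite addrACA opprD.
  have -> : x - u n - (x - u m) = u m - u n.
    by rewrite opprB addrC addrA subrK.
  rewrite rnormZ (rnormB (u m)).
  have -> : real_part `|2 : F| = 2.
    apply: real_part_eq; rewrite normr_nat -[2]/(1 + 1) scalar_of_realD.
    by rewrite scalar_of_real1.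
  have sq_le (a b : R) : 0 <= a -> a <= b -> a ^+ 2 <= b ^+ 2.
    by move=> a0 ab; rewrite lerXn2r// nnegrE// (le_trans a0).
  have e1 : n.+1%:R^-1 <= 1 :> R by rewrite invf_le1 ?ler1n.
  have e0 : 0 <= n.+1%:R^-1 :> R by rewrite invr_ge0.
  have nm' : m.+1%:R^-1 <= n.+1%:R^-1 :> R by rewrite lef_pV2 ?posrE// ler_nat.
  have hz := sq_le _ _ d0 (dle z Mz).
  have hn2 := sq_le _ _ (rnorm_ge0 _) (ltW hn).
  have hm2 := sq_le _ (d + n.+1%:R^-1) (rnorm_ge0 _)
    (ltW (lt_le_trans hm (lerD (lexx d) nm'))).
  move: e1 e0 hz hn2 hm2; set e : R := n.+1%:R^-1.
  set p := rnorm (x - z); set q := rnorm (x - u n); set r := rnorm (x - u m).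
  set s := rnorm (u n - u m) => e1 e0 hz hn2 hm2.
  have ee : 0 <= e * (1 - e) by rewrite mulr_ge0// subr_ge0.
  rewrite exprMn sqrrD in hn2 hm2 *.
  nra.
have [|l Ml hl] := rnorm_complete (proj2 cM) (fun n => proj1 (hu n)).
  move=> e e0; have c0 : 0 < d *+ 8 + 4 by lra.
  have [N hN] := inv_small (e ^+ 2 / (d *+ 8 + 4))
    (divr_gt0 (exprn_gt0 2 e0) c0).
  exists N => n Nn; rewrite -(@ltr_pXn2r _ 2)// ?nnegrE ?rnorm_ge0 ?ltW//.
  by rewrite (le_lt_trans (key _ _ Nn))// mulrC -ltr_pdivlMr// hN.
exists l => // y My; apply: le_trans (dle y My).
apply/ler_addgt0Pr => e e0; have e20 : 0 < e / 2 by lra.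
have [N1 h1] := hl _ e20; have [N2 h2] := inv_small _ e20.
pose n := maxn N1 N2.
have := h1 n (leq_maxl _ _); have := h2 n (leq_maxr _ _).
have := (hu n).2; have := rnormD (x - u n) (u n - l).
rewrite addrA subrK (rnormB (u n)); move: (n.+1%:R^-1) => a; lra.
Qed.

(** Moving the best approximation [l] by the component of [x - l] along [y] cannot decrease the
    distance, so by [norm_sub_proj] that component vanishes. *)
Lemma orthogonal_projection_exists (M : set H) x : closed_subspace M ->
  exists2 l, M l & forall y, M y -> inner (x - l) y = 0.
Proof.
move=> cM; have [l Ml hl] := best_approximation x cM.
exists l => // y My; have [->|y0] := eqVneq y 0; first exact: linear0r.
have := hl (l + (inner (x - l) y / inner y y) *: y).
rewrite opprD addrA => /(_ _)/wrap[].
  by apply: closed_subspaceD => //; exact: closed_subspaceZ.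
rewrite rnorm_leP -(@ler_pXn2r _ 2)// ?nnegrE// norm_sub_proj//.
rewrite lerDl oppr_ge0 pmulr_lle0 ?invr_gt0 ?exprn_gt0 ?normr_gt0// => h.
apply/eqP; rewrite -normr_eq0 -sqrf_eq0.
by rewrite eq_le h exprn_ge0.
Qed.

(** The foot of the perpendicular is unique, hence linear in [x]. Since [|f x|^2] is the inner
    product of [x] and [f x], Cauchy-Schwarz bounds its norm by 1. *)
Lemma orthoprojP (M : set H) : closed_subspace M ->
  is_orthogonal_projection M (orthoproj M).
Proof.
move=> cM; suff [P hP] : exists P : bop H, is_orthogonal_projection M P.
  by apply: (xgetPex (0 : bop H)); exists P.
have /choice[f hf] :
  forall x, exists l, M l /\ forall y, M y -> inner (x - l) y = 0.
  by move=> x; have [l] := orthogonal_projection_exists x cM; exists l.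
have f_uniq x l : M l -> (forall y, M y -> inner (x - l) y = 0) -> f x = l.
  move=> Ml hl; have [Mf hfx] := hf x.
  apply/eqP; rewrite -subr_eq0; apply/eqP/inner_eq0.
  have Md : M (f x - l) by exact: closed_subspaceB.
  rewrite -{1}[f x](subKr x) -addrA [- _ + _]addrC addrA innerBl.
  by rewrite hl// hfx// subrr.
have f_bl : f \in @bounded_linear R k H.
  apply/asboolP; split=> [a x y|].
    have [[Mx hx] [My hy]] := (hf x, hf y).
    apply: f_uniq => [|z Mz]; first exact: closed_subspace_lin.
    by rewrite opprD addrACA -scalerBr innerDl innerZl hx// hy// mulr0 addr0.
  exists 1 => x; rewrite mul1r; have [Mx hx] := hf x.
  have [->|fx0] := eqVneq (f x) 0; first by rewrite normr0.
  have nfx0 : 0 < `|f x| by rewrite normr_gt0.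
  rewrite -(ler_pM2r nfx0) -expr2 -inner_norm
    (le_trans _ (Cauchy_Schwarz _ _))//.
  have := hx _ Mx; rewrite innerBl => /eqP; rewrite subr_eq0 => /eqP ->.
  by rewrite ger0_norm// inner_norm exprn_ge0.
by exists (BOp f_bl).
Qed.

Lemma dyad_bounded_linear (u v : H) :
  (fun x => inner x v *: u) \in @bounded_linear R k H.
Proof.
apply/asboolP; split=> [a x y|].
  by rewrite innerDl innerZl scalerDl scalerA.
exists (`|v| * `|u|) => x; rewrite normrZ mulrAC ler_wpM2r//.
by rewrite mulrC; exact: Cauchy_Schwarz.
Qed.

Definition dyad (u v : H) : bop H := BOp (dyad_bounded_linear u v).

Lemma bop_scaleAl (a : F) (S T : bop H) : (a *: S) * T = a *: (S * T).
Proof. exact: bopP. Qed.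

Lemma bop_scaleAr (a : F) (S T : bop H) : S * (a *: T) = a *: (S * T).
Proof. by apply: bopP => x; exact: linearZ. Qed.

(** * Invertibility of large shifts of an operator *)

Lemma bop_natE n (x : H) : (n%:R : bop H) x = (n%:R : F) *: x.
Proof. by rewrite -[n%:R in LHS](scaler_nat n (1 : bop H)). Qed.

Lemma real_part_natV n : real_part `|(n%:R : F)^-1| = n%:R^-1.
Proof.
apply: real_part_eq; rewrite normfV normr_nat.
have snat m : sor m%:R = m%:R.
  elim: m => [|m IH]; first exact: scalar_of_real0.
  by rewrite !mulrS scalar_of_realD scalar_of_real1 IH.
have [->|n0] := eqVneq n 0%N; first by rewrite !invr0 scalar_of_real0.
apply: (@mulfI _ (n%:R : F)); first by rewrite pnatr_eq0.
rewrite -[in RHS]snat -scalar_of_realM divff ?divff ?pnatr_eq0//.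
by rewrite scalar_of_real1.
Qed.

(** Banach's iteration; starting at 0 keeps every iterate, hence the limit, in [M]. *)
Lemma contraction_fixpoint (M : set H) (f : H -> H) : closed M ->
  M 0 -> (forall z, M z -> M (f z)) ->
  (forall y z, rnorm (f y - f z) <= rnorm (y - z) / 2) ->
  exists2 z, M z & f z = z.
Proof.
move=> cM M0 Mf fc; pose u n := iter n f 0.
have Mu n : M (u n) by elim: n => //= n; exact: Mf.
pose D := rnorm (u 1%N - u 0%N).
have D0 : 0 <= D by exact: rnorm_ge0.
(* The bound [2D] reproduces itself, as [D + 2D/2 = 2D]. *)
have h1 p : rnorm (u 0%N - u p) <= D * 2.
  elim: p => [|p IH]; first by rewrite subrr /rnorm normr0
    (@real_part_eq R k 0 0) ?scalar_of_real0//; lra.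
  have := rnormD (u 0%N - u 1%N) (u 1%N - u p.+1); rewrite addrA subrK.
  have := fc (u 0%N) (u p); rewrite -/(u 1%N) -/(u p.+1) (rnormB (u 0%N)
    (u 1%N)) -/D.
  move: IH; lra.
have h2 m p : rnorm (u m - u (m + p)%N) <= D * 2 / 2 ^+ m.
  elim: m => [|m IH]; first by rewrite expr0 divr1 add0n.
  rewrite (le_trans (fc _ _))// exprS invfM mulrA [_ / 2 / _]mulrAC.
  by rewrite ler_pM2r// invr_gt0.
have [|l Ml hl] := rnorm_complete cM Mu.
  move=> e e0; pose N := Num.bound (D * 2 / e); exists N => n Nn.
  rewrite -(subnKC Nn) (le_lt_trans (h2 _ _))// ltr_pdivrMr ?exprn_gt0//.
  rewrite -ltr_pdivrMl// mulrC; apply: (@lt_trans _ _ N%:R).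
    by apply: archi_boundP; rewrite divr_ge0 ?mulr_ge0 ?(ltW e0).
  by rewrite -natrX ltr_nat ltn_expl.
exists l => //; apply/eqP; rewrite -subr_eq0; apply/eqP/rnorm_eq0/eqP.
rewrite eq_le rnorm_ge0 andbT; apply/ler_addgt0Pr => e e0.
have e20 : 0 < e / 2 by lra.
have [N hN] := hl _ e20.
have := hN N (leqnn _); have := hN N.+1 (leqnSn _).
have := fc (u N) l; have := rnormD (f l - u N.+1) (u N.+1 - l).
rewrite addrA subrK (rnormB (u N.+1) l) (rnormB (u N) l) /= (rnormB (f l)); lra.
Qed.

(** A solution of [(T + n) z = x] is a fixed point of [n^-1 (x - T z)], a contraction that preserves
    every closed invariant subspace containing [x]. *)
Lemma shift_solvable (T : bop H) : exists n0, forall n, (n0 <= n)%N ->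
  (forall z, rnorm z <= rnorm ((T + n%:R) z)) /\
  (forall M x, closed_subspace M -> (forall z, M z -> M (T z)) -> M x ->
     exists2 z, M z & (T + n%:R) z = x).
Proof.
pose C := real_part (opnorm T).
have TC z : rnorm (T z) <= C * rnorm z.
  rewrite -(@le_scalar_of_real R k) scalar_of_realM !rnormE real_partK
    ?opnorm_ge0//.
  exact: opnorm_le.
have C0 : 0 <= C.
  by rewrite -(@le_scalar_of_real R k) scalar_of_real0 real_partK ?opnorm_ge0.
(* [n > 2C] makes the contraction ratio at most 1/2; [n > 2] gives [n^-1 <= 1/2], used in the lower
   bound. *)
exists (Num.bound (C * 2 + 2)) => n n0.
have nC : C * 2 + 2 < n%:R.
  apply: (@lt_le_trans _ _ (Num.bound (C * 2 + 2))%:R); last by rewrite ler_nat.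
  by apply: archi_boundP; lra.
have n_gt0 : 0 < n%:R :> R by lra.
have nF0 : n%:R != 0 :> F.
  by rewrite pnatr_eq0; apply: contraTneq n_gt0 => ->; rewrite ltxx.
pose a : F := n%:R^-1.
have aE z : rnorm (a *: z) = n%:R^-1 * rnorm z by rewrite rnormZ real_part_natV.
have aC z : rnorm (a *: T z) <= rnorm z / 2.
  rewrite aE ler_pdivrMl//; have := rnorm_ge0 z; have := TC z; nra.
split=> [z|M x cM TM Mx].
  have : rnorm (a *: (T + n%:R) z) <= rnorm ((T + n%:R) z) / 2.
    by rewrite aE mulrC ler_wpM2l ?rnorm_ge0// lef_pV2 ?posrE//; lra.
  have -> : a *: (T + n%:R) z = a *: T z + z.
    by rewrite -[(T + n%:R) z]/(T z + (n%:R : bop H) z)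
      bop_natE scalerDr scalerA mulVf// scale1r.
  have := rnormD (a *: T z + z) (- (a *: T z));
    rewrite addrAC subrr add0r rnormN.
  have := aC z; have := rnorm_ge0 z; lra.
have [||z Mz zE] := @contraction_fixpoint M (fun z => a *: (x - T z))
  (proj2 cM) (closed_subspace0 cM).
- by move=> z Mz; apply: closed_subspaceZ => //; apply: closed_subspaceB => //;
  exact: TM.
- move=> y z; rewrite -scalerBr opprB addrC addrA subrK -linearB.
  by rewrite (rnormB y) aC.
exists z => //; rewrite -[(T + n%:R) z]/(T z + (n%:R : bop H) z) bop_natE.
by rewrite -[in n%:R *: z]zE scalerA divff// scale1r addrC subrK.
Qed.
End hilbert.

(** * Subspace lattices *)

Section lattice.
Context {R : realType} {k : scalar_kind} {H : hilbertType R k}.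
Local Notation F := (scalars R k).
Implicit Types (x y z u : H) (M N : set H) (S T : bop H).

Lemma orthoproj_id M x : closed_subspace M -> M x -> orthoproj M x = x.
Proof.
move=> cM Mx; have [MP hP] := orthoprojP cM x.
apply/eqP; rewrite eq_sym -subr_eq0; apply/eqP/inner_eq0.
by apply: hP; exact: closed_subspaceB.
Qed.

Lemma closed_join_sub (C : set (set H)) M : C M -> M `<=` closed_join C.
Proof.
move=> CM x Mx; apply: subset_closure => V [_ CV].
by apply: CV; exists M.
Qed.

Lemma closed_join_trivial (C : set (set H)) :
  (forall M, C M -> M = [set 0]) -> closed_join C `<=` [set 0].
Proof.
move=> C0 x; have -> : [set 0] = closure [set (0 : H)].
  by apply/closure_id; apply: accessible_closed_set1;
    apply: hausdorff_accessible; exact: norm_hausdorff.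
apply: closureS => {}x; apply.
split; last by move=> y [M /C0 -> ->].
split; first by rewrite inE.
by move=> a y z; rewrite !inE => -> ->; rewrite scaler0 addr0.
Qed.

Variable Lat : set (set H).
Hypothesis LatP : subspace_lattice Lat.

Let cLat M : Lat M -> closed_subspace M.
Proof. by case: LatP => h _ _ _ _; exact: h. Qed.

Lemma Alg1 : Alg Lat 1.
Proof. by move=> M LM _ [x Mx <-]. Qed.

Lemma AlgB S T : Alg Lat S -> Alg Lat T -> Alg Lat (S - T).
Proof.
move=> AS AT M LM _ [x Mx <-].
by apply: (closed_subspaceB (cLat LM)); [apply: AS|apply: AT] => //; exists x.
Qed.

Lemma AlgM S T : Alg Lat S -> Alg Lat T -> Alg Lat (S * T).
Proof.
move=> AS AT M LM _ [x Mx <-]; apply: AS => //; exists (T x) => //.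
by apply: AT => //; exists x.
Qed.

Lemma AlgZ (a : F) T : Alg Lat T -> Alg Lat (a *: T).
Proof.
move=> AT M LM _ [x Mx <-]; apply: (closed_subspaceZ _ (cLat LM)).
by apply: AT => //; exists x.
Qed.

Lemma Alg0 : Alg Lat 0.
Proof. by rewrite -(subrr 1); apply: AlgB; exact: Alg1. Qed.

(** The inverse stays in [Alg Lat]: for [x] in [M] the equation is solvable inside [M], and its
    solution is unique by the lower bound, which also bounds the inverse. *)
Lemma Alg_inv_shift T : Alg Lat T ->
  exists n,
    (exists S, [/\ Alg Lat S, (T + n%:R) * S = 1 & S * (T + n%:R) = 1]) /\
    exists S, [/\ Alg Lat S, (T + n.+1%:R) * S = 1 & S * (T + n.+1%:R) = 1].
Proof.
move=> AT; have [n0 hn0] := shift_solvable T.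
suff inv n : (n0 <= n)%N ->
    exists S, [/\ Alg Lat S, (T + n%:R) * S = 1 & S * (T + n%:R) = 1].
  by exists n0; split; apply: inv.
move=> /hn0[lb solve]; pose Tn := T + n%:R.
have inj y z : Tn y = Tn z -> y = z.
  move=> yz; apply/eqP; rewrite -subr_eq0; apply/eqP/rnorm_eq0/eqP.
  rewrite eq_le rnorm_ge0 andbT (le_trans (lb _))// -/Tn.
  have -> : Tn (y - z) = 0 by rewrite -(subrr (Tn z)) -{1}yz; exact: linearB.
  by rewrite /rnorm normr0 (real_part_eq (a := 0)) ?scalar_of_real0.
have cT : closed_subspace (setT : set H).
  by apply: cLat; case: LatP.
have /choice[f hf] : forall x, exists z, Tn z = x.
  by move=> x; have [z _ zx] := solve setT x cT (fun _ _ => I) I; exists z.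
have f_bl : f \in @bounded_linear R k H.
  apply/asboolP; split=> [a x y|].
    by apply: inj; rewrite (bop_linear Tn) !hf.
  by exists 1 => x; rewrite mul1r -rnorm_leP (le_trans (lb _))// -/Tn hf.
exists (BOp f_bl); split.
- move=> M LM _ [x Mx <-] /=.
  have TM z : M z -> M (T z) by move=> Mz; apply: AT => //; exists z.
  have [z Mz zx] := solve M x (cLat LM) TM Mx.
  by rewrite (_ : f x = z)//; apply: inj; rewrite hf.
- by apply: bopP => x; exact: hf.
- by apply: bopP => x; apply: inj; rewrite [LHS]hf.
Qed.

Lemma lower_join_Lat N : Lat (lower_join Lat N).
Proof. by case: LatP => _ _ h _ _; apply: h => M []. Qed.

Lemma lower_join_sub N M : Lat M -> ~ N `<=` M -> M `<=` lower_join Lat N.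
Proof. by move=> LM NM; exact: closed_join_sub. Qed.

(** Each member [M] of the lattice either contains [N], hence the range of [T], or lies in
    [lower_join Lat N], where [T] vanishes. *)
Lemma Alg_lower_join N T : Lat N -> (forall x, N (T x)) ->
  (forall x, lower_join Lat N x -> T x = 0) -> Alg Lat T.
Proof.
move=> LN TN T0 M LM _ [x Mx <-].
have [NM|NM] := pselect (N `<=` M); first exact: NM.
rewrite T0; first exact: closed_subspace0 (cLat LM).
exact: (lower_join_sub LM NM).
Qed.

(** Let [K] be the least member containing [y]. If [K] is nonzero, it is the join of the [N] with
    [K] not inside [lower_join Lat N]. A nonzero such [N] would have [y], hence [K], in its lower
    join; so all are zero and [K] collapses. *)
Lemma eq0_of_lower_join L y : completely_distributive Lat -> Lat L -> L y ->
  (forall N, Lat N -> N `<=` L -> N <> [set 0] -> lower_join Lat N y) -> y = 0.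
Proof.
move=> cd LL Ly hy; pose C := [set M | Lat M /\ M y].
pose K := \bigcap_(M in C) M.
have LK : Lat K by case: LatP => _ h _ _ _; apply: h => M [].
have Ky : K y by move=> M [].
have KL : K `<=` L by move=> x; apply.
have [K0|K0] := pselect (K = [set 0]); first by move: Ky; rewrite K0.
have KE := cd K LK K0; move: (Ky); rewrite {1}KE.
apply: closed_join_trivial => N [LN KN].
apply: contrapT => N0; apply: (KN).
have NK : N `<=` K.
  by move=> z Nz; rewrite KE; apply: (closed_join_sub _ Nz); split.
move=> x; apply; split; first exact: lower_join_Lat.
by apply: hy => //; exact: subset_trans KL.
Qed.

(** On [N] the projection onto [M] equals its product with the projection onto [N], which may be
    moved to the left. *)
Lemma Alg_orthoproj M : commutative_lattice Lat -> Lat M ->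
  Alg Lat (orthoproj M).
Proof.
move=> cL LM N LN _ [x Nx <-]; rewrite -(orthoproj_id (cLat LN) Nx).
rewrite -[orthoproj M _]/((orthoproj M * orthoproj N) x) cL//.
by have [] := orthoprojP (cLat LN) (orthoproj M x).
Qed.

End lattice.

(** * Rank-one operators and the vanishing of [d] on the corner *)

Section anticommutator_maps.
Context {R : realType} {k : scalar_kind} {H : hilbertType R k}.
Local Notation F := (scalars R k).
Context {Lat : set (set H)} {L : set H} {d : bop H -> bop H}.
Implicit Types (x y z u : H) (M N : set H) (S T Y : bop H).
Local Notation P := (orthoproj L).
Hypothesis LatP : subspace_lattice Lat.
Hypothesis comm : commutative_lattice Lat.
Hypothesis cd : completely_distributive Lat.
Hypothesis LL : Lat L.
Hypothesis dAlg : forall T, Alg Lat T -> Alg Lat (d T).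
Hypothesis d_lin : forall (a : F) S T, Alg Lat S -> Alg Lat T ->
  d (a *: S + T) = a *: d S + d T.
Hypothesis d_anticomm : forall S T, Alg Lat S -> Alg Lat T ->
  S * T + T * S = P -> (S * d T) *+ 2 + (T * d S) *+ 2 = d P.

Let cLat M : Lat M -> closed_subspace M.
Proof. by case: LatP => h _ _ _ _; exact: h. Qed.

Let dD S T : Alg Lat S -> Alg Lat T -> d (S + T) = d S + d T.
Proof. by move=> AS AT; rewrite -[S]scale1r d_lin// !scale1r. Qed.

Let dZ (a : F) S : Alg Lat S -> d (a *: S) = a *: d S.
Proof.
move=> AS; have d0 : d 0 = 0.
  have A0 := Alg0 LatP.
  by apply: (addrI (d 0)); rewrite -dD// !addr0.
by rewrite -[a *: S]addr0 d_lin ?d0 ?addr0//; exact: Alg0.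
Qed.

Let two_torsion_free T : T + T = 0 -> T = 0.
Proof.
move=> T0; rewrite -[T]scale1r -(@mulVf _ (2 : F)) ?pnatr_eq0//.
by rewrite -scalerA scaler_nat (mulr2n T) T0 scaler0.
Qed.

Let dP_eq S T : Alg Lat S -> Alg Lat T -> S * T + T * S = P + P ->
  S * d T + T * d S = d P.
Proof.
move=> AS AT ST; have n2 : (2 : F) != 0 by rewrite pnatr_eq0.
have half2 (X : bop H) : (2^-1 *: X) *+ 2 = X.
  by rewrite -scaler_nat scalerA divff// scale1r.
rewrite -(@d_anticomm S (2^-1 *: T)) ?dZ//.
- by rewrite bop_scaleAr bop_scaleAl !half2.
- exact: AlgZ.
- by rewrite bop_scaleAr bop_scaleAl -scalerDr ST scalerDr -mulr2n half2.
Qed.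

Let AP : Alg Lat P. Proof. exact: Alg_orthoproj. Qed.

Let PL x : L (P x). Proof. by have [] := orthoprojP (cLat LL) x. Qed.

Let P_id x : L x -> P x = x. Proof. exact: orthoproj_id (cLat LL). Qed.

Let PP : P * P = P.
Proof. by apply: bopP => x; exact: P_id. Qed.

Let PTP T : Alg Lat T -> P * T * P = T * P.
Proof.
by move=> AT; apply: bopP => x; apply: P_id; apply: AT => //; exists (P x).
Qed.

Let Alg_1 := @Alg1 _ _ _ Lat.
Let Alg_B := AlgB LatP.
Let Alg_M := @AlgM _ _ _ Lat.
Let Alg_inv := Alg_inv_shift LatP.

Let idem0 := d_idem (erefl (1 - P)) Alg_1 Alg_B Alg_M AP PP dD dP_eq Alg_inv.
Let offdiag0 :=
  d_offdiag_idem (erefl (1 - P)) Alg_1 Alg_B Alg_M AP PP dD dP_eq Alg_inv.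
Let annihilate := mul_d_eq0 (erefl (1 - P)) two_torsion_free
  Alg_1 Alg_B Alg_M AP PP dD dP_eq Alg_inv.
Let P_d :=
  mulP_d_corner (erefl (1 - P)) Alg_1 Alg_B Alg_M AP PP dD dP_eq Alg_inv.

(** Rank at most one, in the form for which [Alg_lower_join] gives membership in [Alg Lat]; zero is
    included, so the class is stable under products with corner elements. *)
Definition rank_one N T := [/\ P * T = T, T * P = T,
  exists2 u, N u & forall x, exists c : F, T x = c *: u
  & forall x, lower_join Lat N x -> T x = 0].

Lemma rank_one_Alg N T : Lat N -> rank_one N T -> Alg Lat T.
Proof.
move=> LN [_ _ [u Nu Tu] T0]; apply: (Alg_lower_join LatP LN _ T0) => x.
by have [c ->] := Tu x; exact: closed_subspaceZ (cLat LN) _.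
Qed.

Let bopZ T (a : F) x : T (a *: x) = a *: T x.
Proof. exact: linearZ. Qed.

Lemma d_rank_one N T : Lat N -> N `<=` L -> rank_one N T -> d T = 0.
Proof.
move=> LN NL rT; have AT := rank_one_Alg LN rT.
have [PT TP [u Nu Tu] T0] := rT.
(* If [T] kills [N], it is off-diagonal for the projection [E] onto [N]: [E T = T] and [T E = 0]. *)
have [TN|] := pselect (forall x, N x -> T x = 0).
  pose E := orthoproj N.
  have EN x : N (E x) by have [] := orthoprojP (cLat LN) x.
  have E_id x : N x -> E x = x by exact: orthoproj_id (cLat LN).
  have AE : Alg Lat E by exact: Alg_orthoproj.
  have PE : P * E = E by apply: bopP => x; apply: P_id; apply: NL.
  have EP : E * P = E by rewrite /E -comm.
  apply: (offdiag0 AE) => //.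
  - by apply: bopP => x; exact: E_id.
  - apply: bopP => x; apply: E_id; have [c ->] := Tu x.
    exact: closed_subspaceZ (cLat LN) _.
  - by apply: bopP => x; exact: TN.
move=> /existsNP[u' /not_implyP[Nu' Tu'0]].
(* [T = (1 - E) T + E T] for the rank-one idempotent [E] with [T E = T]: the
   first summand is off-diagonal and the second a multiple of [E]. *)
pose w := T u'; have ww0 : inner w w != 0.
  by apply/eqP => /inner_eq0.
(* [D] is normalized to send [w = T u'] back to [u'], so [E] fixes [u'] and has range in its line;
   [E] vanishes wherever [T] does. *)
pose D := (inner w w)^-1 *: dyad u' w; pose E := D * T.
have Dw : D w = u'.
  by rewrite -[D w]/((inner w w)^-1 *: (inner w w *: u'))
    scalerA mulVf// scale1r.
have Eu' : E u' = u' by exact: Dw.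
have EE x : exists c : F, E x = c *: u'.
  by exists ((inner w w)^-1 * inner (T x) w); rewrite -scalerA.
have E_idem : E * E = E.
  apply: bopP => x; rewrite -[(E * E) x]/(E (E x)); have [c ->] := EE x.
  by rewrite bopZ Eu'.
have TE : T * E = T.
  apply: bopP => x; rewrite -[(T * E) x]/(T (D (T x))).
  have [a Tx] := Tu x; have [b Tu'] := Tu u'.
  have b0 : b != 0 by apply: contra_notN Tu'0 => /eqP b0;
    rewrite Tu' b0 scale0r.
  have -> : T x = (a / b) *: w by rewrite Tx /w Tu' scalerA divfK.
  by rewrite 2!bopZ Dw.
have [e ETe] : exists e : F, E * T = e *: E.
  have [e he] := EE (T u'); exists e; rewrite -TE; apply: bopP => x.
  rewrite -[(E * (T * E)) x]/(E (T (E x))) -[(e *: E) x]/(e *: E x).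
  by have [c ->] := EE x; rewrite 2!bopZ he !scalerA mulrC.
have EP : E * P = E by rewrite -mulrA TP.
have PE : P * E = E.
  apply: bopP => x; apply: P_id; have [c ->] := EE x; apply: NL.
  exact: closed_subspaceZ (cLat LN) _.
have AE : Alg Lat E.
  apply: (rank_one_Alg LN); split => //; first by exists u'.
  by move=> x Nx; rewrite -[E x]/(D (T x)) T0// linear0.
clearbody E.
have dET : d (E * T) = 0 by rewrite ETe dZ// idem0// scaler0.
have AET := Alg_M AE AT.
have dT : d (T - E * T) = 0.
  (* The complementary idempotent is [P - E], since it must lie in the corner. *)
  apply: (@offdiag0 (P - E)).
  - exact: Alg_B.
  - by rewrite mulrBr PP PE.
  - by rewrite mulrBl PP EP.
  - by rewrite mulrBr !mulrBl PP PE EP E_idem subrr subr0.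
  - exact: Alg_B.
  - by rewrite mulrBr mulrA PE PT.
  - by rewrite mulrBl -mulrA TP.
  - by rewrite mulrBr !mulrBl !mulrA PT PE E_idem subrr subr0.
  - by rewrite mulrBr !mulrBl -!mulrA TP TE subrr.
by rewrite -[T](subrK (E * T)) dD ?dT ?dET ?addr0//; exact: Alg_B.
Qed.

(** By [eq0_of_lower_join] it suffices to place [y = d Y x] in each lower join [J]. A nonzero
    component [v] of [y] orthogonal to [J] would give a rank-one [T] with [T y] nonzero, against
    [T d(Y) = 0]. *)
Lemma d_corner0 Y : Alg Lat Y -> P * Y = Y -> Y * P = Y -> d Y = 0.
Proof.
move=> AY PY YP; apply: bopP => x; apply: (eq0_of_lower_join LatP cd LL).
  by rewrite -(P_d AY PY YP); exact: PL.
move=> N LN NL N0; set y := d Y x.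
pose J := lower_join Lat N; have LJ : Lat J by exact: lower_join_Lat.
have [Jp hJ] := orthoprojP (cLat LJ) y; pose v := y - orthoproj J y.
have [v0|v0] := eqVneq v 0.
  by have /eqP := v0; rewrite subr_eq0 => /eqP ->.
have [u Nu u0] : exists2 u, N u & u != 0.
  apply: contrapT => h; apply: N0; apply/seteqP; split => [u Nu|_ ->].
    by apply: contrapT => /eqP u0; apply: h; exists u.
  exact: closed_subspace0 (cLat LN).
(* The factor [P] puts [T] in the corner; as [P] preserves [J], which is orthogonal to [v], [T]
   still kills [J]. *)
pose T := dyad u v * P.
have PJ z : J z -> J (P z) by move=> Jz; apply: (AP LJ); exists z.
have TE z : T z = inner (P z) v *: u by [].
have T_J z : J z -> T z = 0.
  by move=> Jz; rewrite TE (@inner_eq0C _ _ _ v (P z)) ?scale0r//;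
    exact: hJ (PJ _ Jz).
have PT : P * T = T.
  by apply: bopP => z; apply: P_id; apply: NL;
    exact: closed_subspaceZ (cLat LN) _.
have TP : T * P = T by rewrite /T -mulrA PP.
clearbody T.
have rT : rank_one N T.
  by split => //; exists u => // z; exists (inner (P z) v); exact: TE.
have YN z : N z -> N (Y z) by move=> Nz; apply: (AY _ LN); exists z.
(* [Y] preserves both [N] and [J], so [T Y] and [Y T] are killed by [d] as well. *)
have rTY : rank_one N (T * Y).
  split; rewrite ?mulrA ?PT// -?mulrA ?YP//.
    by exists u => // z; exists (inner (P (Y z)) v); exact: TE.
  by move=> z Jz; apply: T_J; apply: (AY _ LJ); exists z.
have rYT : rank_one N (Y * T).
  split; rewrite ?mulrA ?PY// -?mulrA ?TP//.
    exists (Y u); first exact: YN.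
    by move=> z; exists (inner (P z) v); rewrite -bopZ -TE.
  by move=> z Jz; rewrite -[(Y * T) z]/(Y (T z)) T_J// linear0.
have AT := rank_one_Alg LN rT.
have := annihilate AT PT TP AY PY YP (d_rank_one LN NL rT)
  (d_rank_one LN NL rTY) (d_rank_one LN NL rYT).
move=> /(congr1 (fun S : bop H => S x)).
rewrite -[(T * d Y) x]/(T y) TE P_id; last first.
  by rewrite /y -(P_d AY PY YP); exact: PL.
have -> : inner y v = inner v v.
  rewrite [in RHS]/v [in RHS]innerBl.
  by rewrite (inner_eq0C (hJ _ Jp)) subr0.
move=> /eqP; rewrite scaler_eq0 (negPf u0) orbF => /eqP/inner_eq0 v_eq0.
by rewrite v_eq0 eqxx in v0.
Qed.

Lemma d_eq_mul_d1 :
  (forall T, Alg Lat T ->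
     (forall S, Alg Lat S -> P * S * (1 - P) * T = 0) -> (1 - P) * T = 0) ->
  (forall T, Alg Lat T -> d T = T * d 1) /\ P * d 1 = 0.
Proof.
move=> faithful.
exact: (d_eq_mulr (erefl (1 - P)) Alg_1 Alg_B Alg_M AP PP PTP dAlg dD dP_eq
  faithful d_corner0).
Qed.
End anticommutator_maps.

Theorem corollary2p8 (R : realType) (k : scalar_kind) (H : hilbertType R k)
    (Lat : set (set H)) (L : set H) (delta : {fun Alg Lat >-> Alg Lat}) :
  subspace_lattice Lat ->
  commutative_lattice Lat ->
  completely_distributive Lat ->
  irreducible_algebra (Alg Lat) ->
  Lat L -> L <> [set 0] -> L <> setT ->
  (forall A, Alg Lat A ->
     (forall T, Alg Lat T -> orthoproj L * T * (1 - orthoproj L) * A = 0) ->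
     (1 - orthoproj L) * A = 0) ->
  (forall (a : scalars R k) A B, Alg Lat A -> Alg Lat B ->
     delta (a *: A + B) = a *: delta A + delta B) ->
  {within Alg Lat, continuous delta} ->
  (forall A B, Alg Lat A -> Alg Lat B -> A * B + B * A = orthoproj L ->
     (A * delta B) *+ 2 + (B * delta A) *+ 2 = delta (orthoproj L))
  <->
  ((forall A, Alg Lat A -> delta A = A * delta 1) /\ orthoproj L * delta 1 = 0).
Proof.
move=> LatP comm cd _ LL _ _ faithful d_lin _; split.
  have delta_Alg A : Alg Lat A -> Alg Lat (delta A) by exact: funS.
  by move=> h; exact: (d_eq_mul_d1 LatP comm cd LL delta_Alg d_lin h faithful).
(* Conversely, the left side becomes [2 (AB + BA) delta(1) = 2 P delta(1) = 0], and
   [delta(P) = P delta(1) = 0]. *)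
move=> [dE Pd1] A B AA AB ABP.
have AP : Alg Lat (orthoproj L) by exact: Alg_orthoproj.
rewrite (dE _ AA) (dE _ AB) (dE _ AP) Pd1 -mulrnDl !mulrA -mulrDl ABP Pd1.
by rewrite mul0rn.
Qed.
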